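(* Let $p\geq 3$ be a prime and let $s,n$ be positive integers. Put $N_p=(n+1)p$ and $D_p=\{x\in\mathbb{Z}:1\leq x\leq pn+p-1,\ p\nmid x\}$. For $b\in\mathbb{Z}_{N_p}$ let $$M_{p,s,n}(b)=\sum_{\substack{(V_1,\ldots,V_s),\ V_i\subseteq D_p\\ \sum_{i=1}^s\sum_{x\in V_i}x\equiv b \pmod{N_p}}}(-1)^{|V_1|+\cdots+|V_s|}.$$ Then $$\left|M_{p,s,n}(b)-\frac{\varSigma_{p,s,n,b}}{n+1}\right|\leq p^{s(n+1)/2},$$ where $\varSigma_{p,s,n,b}=(p-1)\cdot p^{s(n+1)-1}$ if $p\mid b$, and $\varSigma_{p,s,n,b}=-p^{s(n+1)-1}$ otherwise.
   Context: Equivalently, $M_{p,s,n}(b)$ is the sum of the coefficients $t_{i,p,s}$, over $0\le i\le d_{p,s,n}$ with $i\equiv b\pmod{N_p}$, of the polynomial $T_{p,s,n}(q)=\prod_{j=0}^n\prod_{k=1}^{p-1}(1-q^{pj+k})^s=\sum_{i=0}^{d_{p,s,n}}t_{i,p,s}q^i$, where $d_{p,s,n}=p(p-1)s(n+1)^2/2$. The condition $p\mid b$ is well defined for $b\in\mathbb{Z}_{N_p}$ since $p\mid N_p$. *)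

(* Defs.v *)
From mathcomp Require Import all_boot all_order all_algebra.
From mathcomp Require Import reals exp.

Set Implicit Arguments.
Unset Strict Implicit.
Unset Printing Implicit Defensive.

Import Order.TTheory GRing.Theory Num.Theory.
Local Open Scope ring_scope.

Definition modN (p n : nat) : nat := ((n + 1) * p)%N.

(* The ordinal type 'I_(modN p n) is {0, ..., pn + p - 1}, so no element of
   D_p is lost by taking it as the ambient finite type. *)
Definition Dset (p n : nat) : {set 'I_(modN p n)} :=
  [set x : 'I_(modN p n) | (1 <= x <= p * n + p - 1)%N && ~~ (p %| x)%N].

(* 'Z_(modN p n) is the ring of integers modulo modN p n only when
   1 < modN p n, which holds whenever p is prime. *)
Definition Msum (p s n : nat) (b : 'Z_(modN p n)) : int :=
  \sum_(V : {ffun 'I_s -> {set 'I_(modN p n)}} |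
          [forall i, V i \subset Dset p n] &&
          ((\sum_(i < s) \sum_(x in V i) (x : nat))%N%:R == b))
     (-1) ^+ (\sum_(i < s) #|V i|)%N.

(* p %| b is tested on the representative of b in {0, ..., modN p n - 1}; as p
   divides modN p n, this does not depend on the representative. *)
Definition Sig (p s n : nat) (b : 'Z_(modN p n)) : int :=
  if (p %| b)%N then (p%:Z - 1) * p%:Z ^+ (s * (n + 1) - 1)
  else - p%:Z ^+ (s * (n + 1) - 1).

(* Main.v *)
(* Let z be a primitive N-th root of unity, N = (n+1)p. By discrete Fourier inversion, N M(b) is
   the sum over w = z^k of z^(-kb) P(w)^s, where P(w) is the product of the 1 - w^x for x < N
   prime to p. If w^p has order d, then P(w) is 0 (when w^d = 1) or p^((n+1)/d) (when w^d is a
   primitive p-th root of unity). The terms with d = 1 sum exactly to p Sigma; each of the fewer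
   than N others has d >= 2, hence modulus at most p^(s(n+1)/2). *)

Require Import Defs.
From mathcomp Require Import all_boot all_order all_algebra.
From mathcomp Require Import algC cyclotomic ring.
From mathcomp Require Import reals exp.

Import Order.TTheory GRing.Theory Num.Theory.
Local Open Scope ring_scope.

Lemma big_nat_mul_split (T : Type) (idx : T) (op : Monoid.law idx)
    (n k : nat) (F : nat -> T) :
  \big[op/idx]_(0 <= x < n * k) F x =
  \big[op/idx]_(0 <= i < n) \big[op/idx]_(0 <= j < k) F (i * k + j)%N.
Proof.
rewrite big_nat_mul; apply: eq_bigr => i _.
rewrite -{1}[(i * k)%N]add0n big_addn mulSn addnK.
by apply: eq_bigr => j _; rewrite addnC.
Qed.

(** Evaluate the factorisation of X^n - 1 into the X - z^i at [a^-1] and multiply by [a ^+ n]; hence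
    the separate case [a = 0]. *)
Lemma prod_one_sub_scale_prim_root (F : fieldType) (n : nat) (z : F) (a : F) :
  n.-primitive_root z ->
  \prod_(0 <= i < n) (1 - a * z ^+ i) = 1 - a ^+ n.
Proof.
move=> prim_z; have n_gt0 := prim_order_gt0 prim_z.
have [->|a_neq0] := eqVneq a 0.
  by rewrite expr0n gtn_eqF // subr0 big1 // => i _; rewrite mul0r subr0.
have /(congr1 (fun q => a ^+ n * q.[a^-1])) := factor_Xn_sub_1 prim_z.
rewrite horner_prod !hornerE mulrBr mulr1 exprVn mulfV ?expf_neq0 // => <-.
rewrite -[X in a ^+ X](subn0 n) -prodr_const_nat -big_split /=.
by apply: eq_bigr => i _; rewrite !hornerE mulrBr mulfV.
Qed.

(** Cancelling X - 1 from the factorisation of X^n - 1 leaves 1 + X + ... + X^(n-1), whose value at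
    1 is n. *)
Lemma prod_one_sub_prim_root (F : fieldType) (n : nat) (z : F) :
  n.-primitive_root z -> \prod_(1 <= i < n) (1 - z ^+ i) = n%:R.
Proof.
move=> prim_z; have n_gt0 := prim_order_gt0 prim_z.
have := factor_Xn_sub_1 prim_z.
rewrite big_ltn // expr0 subrX1 polyC1 => /(mulfI _) prodE.
have /(congr1 (fun q => q.[1])) := prodE (monic_neq0 (monicXsubC 1)).
rewrite horner_prod horner_sum; under eq_bigr do rewrite !hornerE.
move=> ->; under eq_bigr do rewrite hornerXn expr1n.
by rewrite sumr_const card_ord.
Qed.

Lemma sum_prim_root (F : fieldType) (n : nat) (z : F) (a : nat) :
  n.-primitive_root z ->
  \sum_(0 <= k < n) z ^+ (k * a) = (if (n %| a)%N then n%:R else 0).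
Proof.
move=> prim_z; under eq_bigr do rewrite mulnC exprM.
rewrite big_mkord (prim_order_dvd prim_z); case: eqP => [->|/eqP za_neq1].
  under eq_bigr do rewrite expr1n.
  by rewrite sumr_const card_ord.
apply: (mulfI (x := z ^+ a - 1)); first by rewrite subr_eq0.
by rewrite -subrX1 mulr0 -exprM mulnC exprM (prim_expr_order prim_z) expr1n subrr.
Qed.

Lemma prim_root1 (R : nzRingType) : 1.-primitive_root (1 : R).
Proof. by apply/forallP=> i; rewrite ord1 unity_rootE expr1 !eqxx. Qed.

(** Write x = y p + k. The class k = 0 drops out and every other class gives a power of 1 - w^(dk);
    the product over k is then governed by w^d, a p-th root of unity. *)
Lemma prod_one_sub_coprime (F : fieldType) (p m d : nat) (w : F) :
  prime p -> d.-primitive_root (w ^+ p) -> (0 < m)%N -> (d %| m)%N ->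
  \prod_(0 <= x < m * p | ~~ (p %| x)%N) (1 - w ^+ x) =
  if w ^+ d == 1 then 0 else p%:R ^+ (m %/ d).
Proof.
move=> p_prime prim_u m_gt0 d_dvd_m.
have [p_gt1 d_gt0] := (prime_gt1 p_prime, prim_order_gt0 prim_u).
have p_gt0 := ltnW p_gt1.
rewrite big_mkcond big_nat_mul_split exchange_big /= big_ltn // big1 ?mul1r; last first.
  by move=> i _; rewrite addn0 dvdn_mull.
(* For fixed k, w ^+ (y * p + k) = w ^+ k * (w ^+ p) ^+ y runs m %/ d times through
   w ^+ k times all d-th roots of unity. *)
have prodE k : (1 <= k < p)%N ->
  \prod_(0 <= y < m) (if ~~ (p %| y * p + k)%N then 1 - w ^+ (y * p + k) else 1)
  = (1 - (w ^+ d) ^+ k) ^+ (m %/ d).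
  case/andP=> k_gt0 k_ltp.
  rewrite -{1}(divnK d_dvd_m) big_nat_mul_split.
  rewrite -{2}[(m %/ d)%N]subn0 -prodr_const_nat; apply: eq_bigr => i _.
  rewrite exprAC -(prod_one_sub_scale_prim_root _ _ _ _ prim_u).
  apply: eq_bigr => j _.
  rewrite dvdn_addr ?dvdn_mull // gtnNdvd //=.
  rewrite exprD mulrC [((_ + _) * p)%N]mulnC exprM exprD mulnC exprM.
  by rewrite (prim_expr_order prim_u) expr1n mul1r.
rewrite (eq_big_nat _ _ prodE) prodrXl.
case: eqP => [wd1|/eqP wd_neq1].
  rewrite big_ltn // wd1 expr1n subrr mul0r expr0n.
  by rewrite gtn_eqF // divn_gt0 // dvdn_leq.
rewrite prod_one_sub_prim_root //.
(* The order of w^d divides the prime p and is not 1, so w^d is a primitive p-th root. *)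
have wdp1 : (w ^+ d) ^+ p = 1 by rewrite exprAC (prim_expr_order prim_u).
have [e prim_e] := prim_order_exists p_gt0 wdp1.
move/(primeP p_prime).2 => /orP[]/eqP e_eq; last by rewrite -e_eq.
by move: wd_neq1; rewrite -(expr1 (w ^+ d)) -e_eq (prim_expr_order prim_e) eqxx.
Qed.

Lemma sum_signed_subsets (F : comNzRingType) (N : nat) (D : {set 'I_N}) (w : F) :
  \sum_(V : {set 'I_N} | V \subset D)
    (-1) ^+ #|V| * w ^+ (\sum_(x in V) x)%N =
  \prod_(x in D) (1 - w ^+ x).
Proof.
(* Factors outside [D] become 0 + 1: the expansion then runs over all subsets, and those not
   contained in [D] contribute 0. *)
have -> : \prod_(x in D) (1 - w ^+ x) =
    \prod_x ((if x \in D then - w ^+ x else 0) + 1).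
  rewrite big_mkcond; apply: eq_bigr => x _.
  by case: ifP; rewrite ?add0r // addrC.
rewrite bigA_distr [LHS]big_mkcond /=; apply: eq_bigr => V _.
case: ifPn => [VD|/subsetPn[x xV xND]]; last first.
  by rewrite (bigD1 x) //= xV (negPf xND) mul0r.
rewrite -big_mkcond /= -prodrXr -prodr_const -big_split /=.
by apply: eq_bigr => x xV; rewrite (subsetP VD) // mulN1r.
Qed.

(** The s-th power expands over s-tuples of subsets with total S; summing z^(k(N - b + S)) over k
    keeps exactly S = b mod N. The exponent N - b is -b kept natural. *)
Lemma Msum_fourier (F : fieldType) (p s n : nat) (b : 'Z_(modN p n)) (z : F) :
  (1 < modN p n)%N -> (modN p n).-primitive_root z ->
  (modN p n)%:R * (Msum s b)%:~R =
  \sum_(0 <= k < modN p n) z ^+ (k * (modN p n - b)) *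
     (\prod_(0 <= x < modN p n | ~~ (p %| x)%N) (1 - (z ^+ k) ^+ x)) ^+ s.
Proof.
move=> N_gt1 prim_z; set N := modN p n in z b N_gt1 prim_z *.
have p_gt0 : (0 < p)%N by move: N_gt1; rewrite /N /modN; case: (p); rewrite ?muln0.
have b_ltN : (b < N)%N by rewrite -[X in (_ < X)%N](Zp_cast N_gt1).
have DsetE : Dset p n = [set x : 'I_N | ~~ (p %| x)%N].
  apply/setP=> x; rewrite !inE; case: (boolP (p %| x)%N) => [|pNx]; first by rewrite andbF.
  have x_gt0 : (0 < x)%N by case: (posnP x) pNx => // ->; rewrite dvdn0.
  rewrite x_gt0 !andbT -ltnS subn1 prednK ?addn_gt0 ?p_gt0 ?orbT //.
  by rewrite [(p * n)%N]mulnC -mulSnr -[n.+1]addn1; apply: ltn_ord.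
have prodE k : \prod_(0 <= x < N | ~~ (p %| x)%N) (1 - (z ^+ k) ^+ x) =
    \sum_(V : {set 'I_N} | V \subset Dset p n)
      (-1) ^+ #|V| * (z ^+ k) ^+ (\sum_(x in V) x)%N.
  rewrite sum_signed_subsets DsetE big_mkord.
  by apply: eq_bigl => x; rewrite inE.
under [RHS]eq_bigr => k _.
  rewrite prodE -[X in _ * _ ^+ X](card_ord s) -prodr_const bigA_distr_big /= big_distrr /=.
  over.
rewrite exchange_big /= /Msum rmorph_sum /= mulr_sumr big_mkcondr /=.
apply: eq_big => [V|V VD]; first by apply/forallP/ffun_onP => VD i; apply: VD.
set S := (\sum_(i < s) \sum_(x in V i) x)%N.
under [RHS]eq_bigr => k _.
  rewrite big_split /= prodrXr prodrXr mulrCA -exprM -exprD -mulnDr.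
  over.
rewrite -mulr_sumr sum_prim_root //.
have -> : (S%:R == b) = (N %| N - b + S)%N.
  rewrite -val_eqE /= val_Zp_nat // -[in LHS](modn_small b_ltN) /dvdn.
  by rewrite -(eqn_modDl (N - b)) subnK ?(ltnW b_ltN) // modnn.
case: ifP => _; last by rewrite mulr0.
by rewrite rmorphXn rmorphN1 mulrC.
Qed.

(** Multiplying by n + 1 keeps the estimate in the integers; the halved exponent is rounded down
    because it bounds the integer (n+1)/d. *)
Lemma Msum_near_Sig (p s n : nat) (b : 'Z_(modN p n)) :
  prime p -> (0 < s)%N ->
  `|(n + 1)%:R * Msum s b - Sig s b| <= (n + 1)%:R * p%:R ^+ (s * (n + 1)./2) :> int.
Proof.
move=> p_prime s_gt0.
have [p_gt0 p_gt1] := (prime_gt0 p_prime, prime_gt1 p_prime).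
have N_gt1 : (1 < modN p n)%N by rewrite /modN addn1 mulSn ltn_addr.
have n1_gt0 : (0 < n + 1)%N by rewrite addn1.
have [z prim_z] := C_prim_root_exists (ltnW N_gt1).
have b_ltN : (b < modN p n)%N by rewrite -[X in (_ < X)%N](Zp_cast N_gt1).
pose F k := z ^+ (k * (modN p n - b)) *
  (\prod_(0 <= x < modN p n | ~~ (p %| x)%N) (1 - (z ^+ k) ^+ x)) ^+ s.
have zNk k : (z ^+ k) ^+ p ^+ (n + 1) = 1.
  by rewrite -exprM mulnC exprAC (prim_expr_order prim_z) expr1n.
have prim_eta : p.-primitive_root (z ^+ (n + 1)).
  by have := dvdn_prim_root prim_z (dvdn_mull (n + 1) (dvdnn p)); rewrite mulnK.
(* The frequencies j * (n + 1) are those with (z ^+ k) ^+ p = 1. *)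
have main : \sum_(0 <= j < p) F (j * (n + 1))%N = p%:R * (Sig s b)%:~R.
  (* Here d = 1, and z^(n+1) is a primitive p-th root, so the product vanishes exactly when p
     divides j. *)
  have FE j : F (j * (n + 1))%N = (z ^+ (n + 1)) ^+ (j * (modN p n - b)) *
      (if (p %| j)%N then 0 else p%:R ^+ (s * (n + 1))).
    have etaE : z ^+ (j * (n + 1)) = (z ^+ (n + 1)) ^+ j by rewrite mulnC exprM.
    have prim1 : 1.-primitive_root (z ^+ (j * (n + 1)) ^+ p).
      by rewrite etaE exprAC (prim_expr_order prim_eta) expr1n prim_root1.
    rewrite /F (prod_one_sub_coprime _ _ _ _ _ p_prime prim1) ?dvd1n // expr1 divn1.
    rewrite etaE -(prim_order_dvd prim_eta) [(j * (n + 1))%N]mulnC -mulnA exprM.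
    by congr (_ * _); case: ifP => _; rewrite ?expr0n ?gtn_eqF // -exprM mulnC.
  (* The term j = 0 vanishes; adding and subtracting p^(s(n+1)) completes the others to a full
     character sum. *)
  have F0 : \sum_(0 <= j < p) F (j * (n + 1))%N =
      p%:R ^+ (s * (n + 1)) * \sum_(0 <= j < p) (z ^+ (n + 1)) ^+ (j * (modN p n - b))
      - p%:R ^+ (s * (n + 1)).
    rewrite !(big_ltn p_gt0) !FE dvdn0 mulr0 add0r mul0n expr0 mulrDr mulr1 addrC addKr.
    rewrite mulr_sumr; apply: eq_big_nat => j /andP[j_gt0 j_ltp].
    by rewrite FE gtnNdvd // mulrC.
  rewrite F0 sum_prim_root // dvdn_subr ?(ltnW b_ltN) //; last by rewrite /modN dvdn_mull.
  rewrite -{1 2}[(s * (n + 1))%N]prednK ?muln_gt0 ?s_gt0 // exprS -subn1.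
  rewrite /Sig; case: ifP => _.
    by rewrite rmorphM rmorphB rmorphXn /=; ring.
  by rewrite rmorphN rmorphXn /=; ring.
have small i j : (0 < i < n + 1)%N -> `|F (j * (n + 1) + i)%N| <= p%:R ^+ (s * (n + 1)./2).
  move=> i_range; rewrite /F; set k := (j * (n + 1) + i)%N.
  have [d prim_d d_dvd] := prim_order_exists n1_gt0 (zNk k).
  have norm_z : `|z| = 1.
    apply/eqP; rewrite -(pexpr_eq1 (ltnW N_gt1)) ?normr_ge0 //.
    by rewrite -normrX (prim_expr_order prim_z) normr1.
  rewrite (prod_one_sub_coprime _ _ _ _ _ p_prime prim_d) //.
  rewrite normrM !normrX norm_z expr1n mul1r.
  (* If d = 1, then N divides k p, so n + 1 divides k and hence i, against 0 < i < n + 1. *)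
  have d_gt1 : (1 < d)%N.
    rewrite ltn_neqAle (prim_order_gt0 prim_d) andbT eq_sym; apply/eqP=> d1.
    have := prim_expr_order prim_d; rewrite d1 expr1 -exprM => /eqP.
    rewrite -(prim_order_dvd prim_z) /modN dvdn_pmul2r // dvdn_addr ?dvdn_mull //.
    by case/andP: i_range => i_gt0 i_ltn; rewrite gtnNdvd.
  case: ifP => _; first by rewrite normr0 expr0n gtn_eqF // exprn_ge0 ?ler0n.
  rewrite normrX normr_nat -exprM mulnC ler_weXn2l ?ler1n //.
  by rewrite leq_mul2l -divn2 leq_div2l ?orbT.
have := Msum_fourier _ p s n b z N_gt1 prim_z.
(* Split k = j(n+1) + i with j < p; i = 0 gives the main term. *)
rewrite {2}/modN mulnC big_nat_mul_split.
under eq_bigr do rewrite big_ltn // addn0.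
rewrite big_split /= main => fourier.
have p_gt0C : 0 < p%:R :> algC by rewrite ltr0n.
rewrite -(ler_int algC) intr_norm rmorphB !rmorphM rmorphXn !rmorph_nat.
(* The factor p turns n + 1 into N, so [fourier] applies and the main term cancels. *)
rewrite -(ler_pM2l p_gt0C) -{1}(gtr0_norm p_gt0C) -normrM mulrBr mulrA.
rewrite -natrM mulnC fourier [X in X - _]addrC addrK.
apply: le_trans (ler_norm_sum _ _ _) _.
rewrite [leRHS](_ : _ = \sum_(0 <= j < p) (p%:R ^+ (s * (n + 1)./2) *+ (n + 1)));
  last by rewrite sumr_const_nat subn0 !mulr_natl.
apply: ler_sum => j _; apply: le_trans (ler_norm_sum _ _ _) _.
apply: (@le_trans _ _ (\sum_(1 <= i < n + 1) p%:R ^+ (s * (n + 1)./2))).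
  by apply: ler_sum_nat => i /andP[i_gt0 i_ltn]; apply: small; rewrite i_gt0.
by rewrite sumr_const_nat ler_wpMn2l ?exprn_ge0 ?ler0n // leq_subr.
Qed.

Theorem theorem4p1 (R : realType) (p s n : nat)
  (p_prime : prime p) (p_ge3 : (3 <= p)%N) (s_gt0 : (0 < s)%N) (n_gt0 : (0 < n)%N)
  (b : 'Z_(modN p n)) :
  `| (Msum s b)%:~R - (Sig s b)%:~R / (n + 1)%:R | <= p%:R `^ ((s * (n + 1))%:R / 2) :> R.
Proof.
have n1_gt0 : 0 < (n + 1)%:R :> R by rewrite ltr0n addn1.
have p_ge1 : 1 <= p%:R :> R by rewrite ler1n prime_gt0.
(* Rounding the exponent down only decreases the power, since p >= 1. *)
apply: (@le_trans _ _ (p%:R ^+ (s * (n + 1)./2))); last first.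
  rewrite -powR_mulrn ?ler0n //; apply: ler_powR => //.
  rewrite ler_pdivlMr // -natrM ler_nat -mulnA leq_mul2l muln2.
  by rewrite -[X in (_ <= X)%N](odd_double_half (n + 1)) leq_addl orbT.
rewrite -(ler_pM2l n1_gt0) -{1}(gtr0_norm n1_gt0) -normrM mulrBr.
rewrite [_ * (_ / _)]mulrC divfK ?gt_eqF //.
have := Msum_near_Sig p s n b p_prime s_gt0.
by rewrite -(ler_int R) intr_norm rmorphB !rmorphM rmorphXn !rmorph_nat.
Qed.
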